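(* For $n,k\ge0$ let $p_{n,k}$ be the number of isomorphism classes of (2+2)-free posets with $n$ elements and exactly $k$ minimal elements. Then, as formal power series in $t,z$, $$\sum_{n,k\ge0}p_{n,k}t^nz^k=1+\sum_{n\ge0}\frac{zt}{(1-zt)^{n+1}}\prod_{i=1}^n\bigl(1-(1-t)^i\bigr).$$
   Context: Posets are finite and unlabeled (counted up to isomorphism); the empty poset counts as the unique poset with $0$ elements (so $p_{0,0}=1$). A poset is (2+2)-free if it has no induced subposet isomorphic to the disjoint union of two 2-element chains. An empty product equals $1$. *)

(* Defs.v *)
From mathcomp Require Import all_boot all_order all_algebra.
From mathcomp Require Import fingroup perm.
Set Implicit Arguments. Unset Strict Implicit. Unset Printing Implicit Defensive.
Import GRing.Theory Num.Theory.
Local Open Scope ring_scope.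

(* A binary relation on 'I_n, as a finite object (so it can be counted). *)
Definition relI (n : nat) := {ffun 'I_n -> {ffun 'I_n -> bool}}.

Definition is_poset n (R : relI n) : bool :=
  [&& [forall x, R x x],
      [forall x, forall y, (R x y && R y x) ==> (x == y)] &
      [forall x, forall y, forall z, (R x y && R y z) ==> R x z]].

Definition strict_lt n (R : relI n) (x y : 'I_n) : bool := R x y && (x != y).
Definition incomparable n (R : relI n) (x y : 'I_n) : bool := ~~ R x y && ~~ R y x.

Definition two_plus_two_free n (R : relI n) : bool :=
  ~~ [exists a, exists b, exists c, exists d,
        [&& strict_lt R a b, strict_lt R c d,
            incomparable R a c, incomparable R a d,
            incomparable R b c & incomparable R b d]].

Definition is_minimal n (R : relI n) (x : 'I_n) : bool :=
  [forall y, R y x ==> (y == x)].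

Definition num_minimal n (R : relI n) : nat := #|[set x | is_minimal R x]|.

Definition rel_iso n (R R' : relI n) : bool :=
  [exists s in [set: {perm 'I_n}], [forall x, forall y, R x y == R' (s x) (s y)]].

Definition P22 (n k : nat) : {set relI n} :=
  [set R : relI n | [&& is_poset R, two_plus_two_free R & num_minimal R == k]].

Definition p22 (n k : nat) : nat :=
  #|[set [set R' : relI n | rel_iso R R'] | R in P22 n k]|.

(* f n k = coefficient of t^n z^k *)
Definition fps := nat -> nat -> int.

Definition fps_const (c : int) : fps := fun n k => if (n == 0%N) && (k == 0%N) then c else 0.
Definition fps_one : fps := fps_const 1.
Definition fps_t : fps := fun n k => if (n == 1%N) && (k == 0%N) then 1 else 0.
Definition fps_z : fps := fun n k => if (n == 0%N) && (k == 1%N) then 1 else 0.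
Definition fps_add (f g : fps) : fps := fun n k => f n k + g n k.
Definition fps_opp (f : fps) : fps := fun n k => - f n k.
Definition fps_sub (f g : fps) : fps := fps_add f (fps_opp g).
Definition fps_mul (f g : fps) : fps := fun n k =>
  \sum_(i < n.+1) \sum_(j < k.+1) f i j * g (n - i)%N (k - j)%N.
Definition fps_pow (f : fps) (m : nat) : fps := iter m (fps_mul f) fps_one.
Definition fps_prod (s : seq nat) (F : nat -> fps) : fps :=
  foldr (fun i acc => fps_mul (F i) acc) fps_one s.
Definition fps_sum (s : seq nat) (F : nat -> fps) : fps :=
  foldr (fun i acc => fps_add (F i) acc) (fps_const 0) s.

(* Multiplicative inverse of a series with constant term 1, computed by the
   usual recursion g_{0,0} = 1,
   g_{n,k} = - sum_{(i,j) <> (0,0), i<=n, j<=k} f_{i,j} g_{n-i,k-j};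
   d is fuel, always >= n + k in the recursion. *)
Fixpoint fps_inv_aux (f : fps) (d : nat) (n k : nat) : int :=
  if (n == 0%N) && (k == 0%N) then 1 else
  match d with
  | 0 => 0
  | d'.+1 => - \sum_(i < n.+1) \sum_(j < k.+1)
                 (if ((i : nat) == 0%N) && ((j : nat) == 0%N) then 0
                  else f i j * fps_inv_aux f d' (n - i)%N (k - j)%N)
  end.
Definition fps_inv (f : fps) : fps := fun n k => fps_inv_aux f (n + k)%N n k.

Definition term8 (m : nat) : fps :=
  fps_mul (fps_mul (fps_mul fps_z fps_t)
                   (fps_inv (fps_pow (fps_sub fps_one (fps_mul fps_z fps_t)) m.+1)))
          (fps_prod (iota 1 m)
             (fun i => fps_sub fps_one (fps_pow (fps_sub fps_one fps_t) i))).

(* Main.v *)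
From HB Require Import structures.
Require Import Defs.
From mathcomp Require Import all_boot all_order all_algebra.
From mathcomp Require Import fingroup perm boolp ring zify.
Set Implicit Arguments. Unset Strict Implicit. Unset Printing Implicit Defensive.
Import GRing.Theory Num.Theory.
Local Open Scope ring_scope.

(** A (2+2)-free poset is an interval order, whose strict down-sets form a chain.
    Numbering the chain gives each element a left and a right endpoint, and the
    isomorphism class is determined by the matrix counting the elements with given
    endpoints. The matrices obtained are the Fishburn matrices: upper triangular
    with no zero row or column; the first row counts the minimal elements.

    For 0/1 Fishburn matrices of dimension m, let G_m(u, s) be the generating
    function with weight u for each 1 of the first row and s for the others.
    Merging the first two rows yields
      G_(m+1)(u, s) = u (G_m(u + s + u s, s) - G_m(u, s)).
    Natural-number entries are obtained with 1 + u = 1/(1 - z t) and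
    1 + s = 1/(1 - t), and then u + s + u s replaces 1 + u by (1 + u)/(1 - t).
    With q = 1 - t and V = 1 - z t, the sum H(V) of all the G_m therefore satisfies
    H(V) = 1 + (1 - V) H(q V), which has a unique solution t-adically; a telescoping
    sum shows that the right-hand side of the theorem is also a solution. *)

(** * Fishburn matrices *)

Definition fishburn m (S : 'M[bool]_m) : bool :=
  [&& [forall i, forall j, S i j ==> (i <= j)%N],
      [forall i, exists j, S i j] & [forall j, exists i, S i j]].

Lemma fishburnP m (S : 'M[bool]_m) :
  reflect [/\ forall i j, S i j -> (i <= j)%N, forall i, exists j, S i j
            & forall j, exists i, S i j] (fishburn S).
Proof.
apply: (iffP and3P) => -[up rows cols]; split.
- by move=> i j; move/forallP/(_ i)/forallP/(_ j)/implyP: up; apply.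
- by move=> i; move/forallP/(_ i)/existsP: rows.
- by move=> j; move/forallP/(_ j)/existsP: cols.
- by apply/forallP => i; apply/forallP => j; apply/implyP/up.
- by apply/forallP => i; apply/existsP/rows.
- by apply/forallP => j; apply/existsP/cols.
Qed.

Definition join_row n (a b : 'rV[bool]_n) : 'rV[bool]_n := \row_j (a 0 j || b 0 j).

(** Triangularity leaves the first column only its corner, which must be 1 since that column is
    nonzero. Once the column is deleted, merging the rows [b] and [a] preserves triangularity and
    the nonzero columns. Only the condition that the second row [a] is nonzero gets lost, so it is
    stated separately. *)
Lemma fishburn_split m (x : 'M[bool]_1) (b : 'rV[bool]_(1 + m)) (z : 'cV[bool]_(1 + m))
    (a : 'rV[bool]_(1 + m)) (T : 'M[bool]_(m, 1 + m)) :
  fishburn (col_mx (row_mx x b) (row_mx z (col_mx a T)) : 'M_(1 + (1 + m))) =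
  [&& x == const_mx true, z == const_mx false, a != const_mx false
    & fishburn (col_mx (join_row a b) T : 'M_(1 + m))].
Proof.
rewrite -[col_mx (row_mx x b) _]/(block_mx x b z (col_mx a T)); set S := block_mx _ _ _ _.
have Sx : S (lshift _ 0) (lshift _ 0) = x 0 0 by rewrite /S block_mxEul.
have Sb j : S (lshift _ 0) (rshift _ j) = b 0 j by rewrite /S block_mxEur.
have Sz i : S (rshift _ i) (lshift _ 0) = z i 0 by rewrite /S block_mxEdl.
have Sa j : S (rshift _ (lshift _ 0)) (rshift _ j) = a 0 j.
  by rewrite /S block_mxEdr col_mxEu.
have ST i j : S (rshift _ (rshift _ i)) (rshift _ j) = T i j.
  by rewrite /S block_mxEdr col_mxEd.
set S' := col_mx (join_row a b) T.
have S'c j : S' (lshift _ 0) j = a 0 j || b 0 j by rewrite /S' col_mxEu mxE.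
have S'T i j : S' (rshift _ i) j = T i j by rewrite /S' col_mxEd.
have S0 : forall i : 'I_1, i = 0 by move=> i; rewrite ord1.
apply/fishburnP/and4P => [[up rows cols]|[/eqP x1 /eqP z0 an0 /fishburnP[up rows cols]]].
  have z0 i : z i 0 = false by apply/negbTE/negP; rewrite -Sz => /up.
  have [j aj] : exists j, a 0 j.
    have [j] := rows (rshift _ (lshift _ 0)).
    case: (split_ordP j) => j' ->; last by rewrite Sa; exists j'.
    by rewrite (S0 j') Sz z0.
  split.
  - apply/eqP/matrixP => i j'; rewrite !ord1 mxE -Sx.
    have [i'] := cols (lshift _ 0); case: (split_ordP i') => i'' ->; first by rewrite (S0 i'').
    by rewrite Sz z0.
  - by apply/eqP/matrixP => i j'; rewrite !ord1 mxE z0.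
  - by apply/eqP => /matrixP/(_ 0 j); rewrite mxE aj.
  apply/fishburnP; split.
  - move=> i j'; case: (split_ordP i) => i' ->; first by rewrite (S0 i').
    by rewrite S'T -ST => /up.
  - move=> i; case: (split_ordP i) => i' ->; first by exists j; rewrite (S0 i') S'c aj.
    have [j'] := rows (rshift _ (rshift _ i')).
    case: (split_ordP j') => j'' ->; first by rewrite (S0 j'') Sz z0.
    by rewrite ST => Tij; exists j''; rewrite S'T.
  - move=> j'; have [i] := cols (rshift _ j'); case: (split_ordP i) => i' ->.
      by rewrite (S0 i') Sb => bj; exists (lshift _ 0); rewrite S'c bj orbT.
    case: (split_ordP i') => i'' ->; last by rewrite ST; exists (rshift _ i''); rewrite S'T.
    by rewrite (S0 i'') Sa => aj'; exists (lshift _ 0); rewrite S'c aj'.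
have [j aj] : exists j, a 0 j.
  apply/existsP; apply: contraNT an0 => /existsPn a0; apply/eqP/matrixP => i j.
  by rewrite ord1 mxE; apply/negbTE.
have zE i : z i 0 = false by rewrite z0 mxE.
split.
- move=> i j'; case: (split_ordP i) => i' ->; first by rewrite (S0 i').
  case: (split_ordP j') => j'' ->; first by rewrite (S0 j'') Sz zE.
  case: (split_ordP i') => i'' ->; first by rewrite (S0 i'').
  by rewrite ST -S'T => /up.
- move=> i; case: (split_ordP i) => i' ->.
    by exists (lshift _ 0); rewrite (S0 i') Sx x1 mxE.
  case: (split_ordP i') => i'' ->; first by exists (rshift _ j); rewrite (S0 i'') Sa.
  by have [j'] := rows (rshift _ i''); exists (rshift _ j'); rewrite ST -S'T.
- move=> j'; case: (split_ordP j') => j'' ->.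
    by exists (lshift _ 0); rewrite (S0 j'') Sx x1 mxE.
  have [i] := cols j''; case: (split_ordP i) => i' ->.
    rewrite (S0 i') S'c => /orP[aj'|bj]; last by exists (lshift _ 0); rewrite Sb.
    by exists (rshift _ (lshift _ 0)); rewrite Sa.
  by rewrite S'T => Tij; exists (rshift _ (rshift _ i')); rewrite ST.
Qed.

(** * Generating function of 0/1 Fishburn matrices *)

Section GeneratingFunction.

Variable A : comNzRingType.
Implicit Types (u s : A).

Lemma big_col_mx (T : finType) m1 m2 n (F : 'M[T]_(m1 + m2, n) -> A) :
  \sum_S F S = \sum_B \sum_C F (col_mx B C).
Proof.
rewrite pair_big /= (reindex (fun p : 'M_(m1, n) * 'M_(m2, n) => col_mx p.1 p.2)) //=.
exists (fun S => (usubmx S, dsubmx S)) => [[B C] _|S _] /=; last exact: vsubmxK.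
by rewrite col_mxKu col_mxKd.
Qed.

Lemma big_row_mx (T : finType) m n1 n2 (F : 'M[T]_(m, n1 + n2) -> A) :
  \sum_S F S = \sum_B \sum_C F (row_mx B C).
Proof.
rewrite pair_big /= (reindex (fun p : 'M_(m, n1) * 'M_(m, n2) => row_mx p.1 p.2)) //=.
exists (fun S => (lsubmx S, rsubmx S)) => [[B C] _|S _] /=; last exact: hsubmxK.
by rewrite row_mxKl row_mxKr.
Qed.

Lemma prod_if0 (I : finType) (P : pred I) (F : I -> A) :
  \prod_i (if P i then F i else 0) = if [forall i, P i] then \prod_i F i else 0.
Proof.
case: ifPn => [/forallP allP|/forallPn[i /negbTE nPi]].
  by apply: eq_bigr => i _; rewrite allP.
by rewrite (bigD1 i) //= nPi mul0r.
Qed.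

Definition mx_weight m n s (S : 'M[bool]_(m, n)) : A :=
  \prod_i \prod_j (if S i j then s else 1).

(** The sum factors over columns: a 1 in [c] comes from a 1 in [b], in [a] or in both, a 0 only from
    two zeros. *)
Lemma sum_join_row n u s (c : 'rV[bool]_n) :
  \sum_b \sum_(a | join_row a b == c) mx_weight u b * mx_weight s a =
  mx_weight (u + s + u * s) c.
Proof.
pose g j (p : bool * bool) : A :=
  if (p.2 || p.1) == c 0 j then (if p.1 then u else 1) * (if p.2 then s else 1) else 0.
transitivity (\prod_j \sum_p g j p); last first.
  rewrite /mx_weight big_ord1; apply: eq_bigr => j _.
  rewrite -(pair_bigA _ (fun x y => g j (x, y))) /= !big_bool /g /=.
  by case: (c 0 j) => /=; ring.
rewrite bigA_distr_bigA /=.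
rewrite (reindex (fun p : 'rV[bool]_n * 'rV[bool]_n => [ffun j => (p.1 0 j, p.2 0 j)])) /=;
  last first.
  exists (fun f => (\row_j (f j).1, \row_j (f j).2)) => [[b a] _|f _] /=.
    by congr (_, _); apply/rowP => j; rewrite mxE ffunE.
  by apply/ffunP => j; rewrite ffunE !mxE; case: (f j).
under eq_bigr do rewrite big_mkcond /=.
rewrite pair_big /=; apply: eq_bigr => -[b a] _ /=.
transitivity (\prod_j (if (a 0 j || b 0 j) == c 0 j
   then (if b 0 j then u else 1) * (if a 0 j then s else 1) else 0)); last first.
  by apply: eq_bigr => j _; rewrite ffunE.
rewrite prod_if0 /mx_weight !big_ord1 big_split.
suff -> : (join_row a b == c) = [forall j, (a 0 j || b 0 j) == c 0 j] by [].
apply/eqP/forallP => [<- j|e]; first by rewrite mxE.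
by apply/rowP => j; rewrite mxE; apply/eqP.
Qed.

Definition fishburn_gf m u s : A :=
  \sum_(S : 'M[bool]_m | fishburn S)
     \prod_i \prod_j (if S i j then if (i == 0 :> nat)%N then u else s else 1).

Lemma mx_weight0 m n s : mx_weight s (const_mx false : 'M_(m, n)) = 1.
Proof. by rewrite /mx_weight big1 // => i _; rewrite big1 // => j _; rewrite mxE. Qed.

Lemma mx_weight1 s : mx_weight s (const_mx true : 'M_1) = s.
Proof. by rewrite /mx_weight !big_ord1 mxE. Qed.

Lemma mx_weight_col m1 m2 n s (B : 'M_(m1, n)) (C : 'M_(m2, n)) :
  mx_weight s (col_mx B C) = mx_weight s B * mx_weight s C.
Proof.
rewrite /mx_weight big_split_ord /=; congr (_ * _); apply: eq_bigr => i _;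
by apply: eq_bigr => j _; rewrite ?col_mxEu ?col_mxEd.
Qed.

Lemma mx_weight_row m n1 n2 s (B : 'M_(m, n1)) (C : 'M_(m, n2)) :
  mx_weight s (row_mx B C) = mx_weight s B * mx_weight s C.
Proof.
rewrite /mx_weight -big_split /=; apply: eq_bigr => i _.
rewrite big_split_ord /=; congr (_ * _);
by apply: eq_bigr => j _; rewrite ?row_mxEl ?row_mxEr.
Qed.

Lemma fishburn_gfE m u s :
  fishburn_gf m.+1 u s =
  \sum_c \sum_(T : 'M[bool]_(m, 1 + m) | fishburn (col_mx c T : 'M_(1 + m)))
     mx_weight u c * mx_weight s T.
Proof.
rewrite /fishburn_gf big_mkcond /= (@big_col_mx _ 1 m).
apply: eq_bigr => c _; rewrite [RHS]big_mkcond; apply: eq_bigr => T _.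
case: ifP => // _; rewrite (@big_split_ord _ _ _ 1 m) /=; congr (_ * _).
  apply: eq_bigr => i _; rewrite ord1; apply: eq_bigr => j _.
  by rewrite (@col_mxEu _ 1 m).
by apply: eq_bigr => i _; apply: eq_bigr => j _; rewrite (@col_mxEd _ 1 m).
Qed.

(* Merging the first two rows of a Fishburn matrix, after removal of its first
   column, gives a Fishburn matrix; a 1 in the merged row comes from the first
   row, the second, or both, and the second row must not vanish. *)
Lemma fishburn_gfSS m u s :
  fishburn_gf m.+2 u s =
  u * (fishburn_gf m.+1 (u + s + u * s) s - fishburn_gf m.+1 u s).
Proof.
rewrite [LHS]fishburn_gfE.
under eq_bigr do rewrite big_mkcond (@big_row_mx _ m.+1 1 m.+1).
(* By [fishburn_split] only the corner [x = 1] contributes, and then only [z = 0] and nonzero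
   [a]. *)
rewrite (@big_row_mx _ 1 1 m.+1) (bigD1 (const_mx true)) //= [X in _ + X]big1 ?addr0; last first.
  move=> x /negbTE x1; apply: big1 => b _; apply: big1 => z _.
  rewrite (@big_col_mx _ 1 m); apply: big1 => a _; apply: big1 => T _.
  by rewrite (@fishburn_split m) x1.
transitivity (u * \sum_b \sum_(a | a != const_mx false)
   \sum_(T : 'M[bool]_(m, 1 + m) | fishburn (col_mx (join_row a b) T : 'M_(1 + m)))
     mx_weight u b * mx_weight s a * mx_weight s T).
  rewrite mulr_sumr; apply: eq_bigr => b _.
  rewrite (bigD1 (const_mx false)) //= [X in _ + X]big1 ?addr0; last first.
    move=> z /negbTE z0.
    rewrite (@big_col_mx _ 1 m); apply: big1 => a _; apply: big1 => T _.
    by rewrite (@fishburn_split m) z0 andbF.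
  rewrite (@big_col_mx _ 1 m) mulr_sumr [RHS]big_mkcond; apply: eq_bigr => a _.
  case: ifP => [an0|/negbFE/eqP->]; last first.
    by apply: big1 => T _; rewrite (@fishburn_split m) !eqxx.
  rewrite mulr_sumr [RHS]big_mkcond; apply: eq_bigr => T _.
  rewrite (@fishburn_split m) !eqxx an0 /=; case: ifP => // _.
  rewrite !mx_weight_row mx_weight1 mx_weight0 (@mx_weight_col 1 m) mul1r.
  by rewrite !mulrA.
congr (_ * _); rewrite !fishburn_gfE.
pose H c : A := \sum_(T : 'M[bool]_(m, 1 + m) | fishburn (col_mx c T : 'M_(1 + m))) mx_weight s T.
have HE x : \sum_c \sum_(T : 'M[bool]_(m, 1 + m) | fishburn (col_mx c T : 'M_(1 + m)))
     mx_weight x c * mx_weight s T = \sum_c mx_weight x c * H c.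
  by apply: eq_bigr => c _; rewrite mulr_sumr.
rewrite !HE; apply/eqP; rewrite eq_sym subr_eq; apply/eqP.
(* The subtracted series, moved to the other side, supplies the missing terms [a = 0], where the
   merged row is [b] itself. The sum over all pairs is then grouped by the merged row using
   [sum_join_row]. *)
transitivity (\sum_b \sum_a mx_weight u b * mx_weight s a * H (join_row a b)).
  under eq_bigr do rewrite -sum_join_row mulr_suml.
  rewrite exchange_big; apply: eq_bigr => b _ /=.
  under eq_bigr do rewrite mulr_suml big_mkcond.
  rewrite exchange_big; apply: eq_bigr => a _ /=.
  by rewrite -big_mkcond (big_pred1 (join_row a b)) // => c; rewrite eq_sym.
rewrite -big_split; apply: eq_bigr => b _ /=.
rewrite (bigD1 (const_mx false)) //= addrC; congr (_ + _).
  by apply: eq_bigr => a _; rewrite mulr_sumr.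
rewrite mx_weight0 mulr1; congr (_ * H _).
by apply/rowP => j; rewrite !mxE.
Qed.

Lemma fishburn_gf0 u s : fishburn_gf 0 u s = 1.
Proof.
rewrite /fishburn_gf (big_pred1 (const_mx true)).
  by rewrite big_ord0.
move=> S /=; have -> : S = const_mx true by apply/matrixP => -[].
rewrite eqxx; by apply/fishburnP; split => -[].
Qed.

Lemma fishburn_gf1 u s : fishburn_gf 1 u s = u.
Proof.
rewrite /fishburn_gf (big_pred1 (const_mx true)) => [|S /=].
  by rewrite !big_ord1 mxE.
apply/fishburnP/eqP => [[_ + _]|->].
  move=> /(_ 0)[j]; rewrite ord1 => Sx; apply/matrixP => i k.
  by rewrite !ord1 mxE.
by split=> [i j|i|j]; [rewrite !ord1 | exists 0; rewrite mxE..].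
Qed.

End GeneratingFunction.

(** * Endpoint representations of interval orders *)

Section IntervalRepresentation.

Variable n : nat.
Implicit Types (R : relI n) (l r : 'I_n -> nat).

(* The minimal endpoint representation of an interval order: [x] becomes the
   interval from [l x] to [r x], and every point below [m] is both a left and a
   right endpoint. *)
Record interval_rep R (m : nat) l r : Prop := IntervalRep {
  rep_le : forall x, (l x <= r x)%N;
  rep_ltm : forall x, (r x < m)%N;
  rep_left : forall i, (i < m)%N -> exists x, l x = i;
  rep_right : forall i, (i < m)%N -> exists x, r x = i;
  repE : forall x y, R x y = (x == y) || (r x < l y)%N }.

Lemma rep_strict R m l r : interval_rep R m l r ->
  forall x y, strict_lt R x y = (r x < l y)%N.
Proof.
move=> rep x y; rewrite /strict_lt (repE rep); case: eqVneq => [->|_]; last by rewrite andbT.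
by rewrite andbF; apply/esym/negbTE; rewrite -leqNgt (rep_le rep).
Qed.

(** Strong induction on [i = l y]. If [i < l' y], choose [x] with [r' x = i] and [z] with
    [l' z = i]. Then [x] is below [y] but not below [z], so [l z <= r x < l y = i], and the
    induction hypothesis at [z] gives [i = l' z <= l z], a contradiction. *)
Lemma rep_left_le R m m' l l' r r' :
  interval_rep R m l r -> interval_rep R m' l' r' -> forall y, (l' y <= l y)%N.
Proof.
move=> rep rep' y; move: {-1}(l y) (erefl (l y)) => i.
elim/ltn_ind: i y => i IHi y ly; rewrite leqNgt; apply/negP => lt_i.
have i_m' : (i < m')%N.
  by apply: leq_trans lt_i (leq_trans (rep_le rep' y) (ltnW (rep_ltm rep' y))).
have [z l'z] := rep_left rep' i_m'; have [x r'x] := rep_right rep' i_m'.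
have xy : (r x < l y)%N by rewrite -(rep_strict rep) (rep_strict rep') r'x.
have xz : (l z <= r x)%N by rewrite leqNgt -(rep_strict rep) (rep_strict rep') r'x l'z ltnn.
have lz : (l z < i)%N by rewrite -ly; apply: leq_ltn_trans xy.
by have := IHi _ lz z erefl; rewrite l'z leqNgt lz.
Qed.

(** The value [r' x] is also a left endpoint [l' y], and left endpoints already agree. Hence
    [r x < r' x] would put [x] below [y], that is, [r' x < l' y = r' x]. *)
Lemma rep_right_le R m m' l l' r r' :
  interval_rep R m l r -> interval_rep R m' l' r' -> forall x, (r' x <= r x)%N.
Proof.
move=> rep rep' x; rewrite leqNgt; apply/negP => lt_r.
have [y l'y] := rep_left rep' (rep_ltm rep' x).
have ly : l y = r' x.
  by rewrite -l'y; apply/eqP; rewrite eqn_leq (rep_left_le rep' rep) (rep_left_le rep rep').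
by move: lt_r; rewrite -ly -(rep_strict rep) (rep_strict rep') l'y ltnn.
Qed.

Lemma rep_size_le R m m' l l' r r' :
  interval_rep R m l r -> interval_rep R m' l' r' -> (m' <= m)%N.
Proof.
move=> rep rep'; case: m' rep' => [//|m'] rep'.
have [x <-] := rep_right rep' (ltnSn m').
exact: leq_ltn_trans (rep_right_le rep rep' x) (rep_ltm rep x).
Qed.

(** This makes the counts of elements with given endpoints an invariant of the poset. *)
Lemma rep_unique R m m' l l' r r' :
  interval_rep R m l r -> interval_rep R m' l' r' ->
  [/\ m = m', l =1 l' & r =1 r'].
Proof.
move=> rep rep'; split=> [|x|x]; apply/eqP; rewrite eqn_leq.
- by rewrite (rep_size_le rep rep') (rep_size_le rep' rep).
- by rewrite (rep_left_le rep rep') (rep_left_le rep' rep).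
- by rewrite (rep_right_le rep rep') (rep_right_le rep' rep).
Qed.

Lemma rep_poset R m l r : interval_rep R m l r -> is_poset R.
Proof.
move=> rep; have lr := rep_le rep; apply/and3P; split.
- by apply/forallP => x; rewrite (repE rep) eqxx.
- apply/forallP => x; apply/forallP => y; apply/implyP; rewrite !(repE rep) (eq_sym y).
  by case: eqVneq => //= _; have := lr x; have := lr y; lia.
- apply/forallP => x; apply/forallP => y; apply/forallP => z; apply/implyP; rewrite !(repE rep).
  case: (eqVneq x y) => [<- /=|_ /= /andP[lt_xy]] //.
  case: (eqVneq y z) => [<-|_ /= lt_yz]; first by rewrite lt_xy orbT.
  by apply/orP; right; move: (lr y); lia.
Qed.

(** For chains [a < b] and [c < d], the incomparabilities of [a], [d] and of [b], [c] close the
    cycle [l d <= r a < l b <= r c < l d]. *)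
Lemma rep_free R m l r : interval_rep R m l r -> two_plus_two_free R.
Proof.
move=> rep; apply/negP => /existsP[a] /existsP[b] /existsP[c] /existsP[d] /and5P[].
rewrite !(rep_strict rep) /incomparable !(repE rep) => ltab ltcd _ + /andP[+ _].
by move=> /andP[/norP[_ +] _] /andP[_ /norP[_ +]]; lia.
Qed.

(** If [l x] is positive, any element with right endpoint 0 lies strictly below [x]. *)
Lemma rep_num_minimal R m l r : interval_rep R m l r ->
  num_minimal R = #|[set x | l x == 0%N]|.
Proof.
move=> rep; apply: eq_card => x; rewrite !inE; apply/forallP/eqP => [minx|lx0 y].
  apply/eqP; rewrite -leqn0 leqNgt; apply/negP => lx_gt0.
  have m_gt0 : (0 < m)%N by apply: leq_trans (leq_ltn_trans _ (rep_ltm rep x)) _.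
  have [y ry0] := rep_right rep m_gt0.
  have lt_yx : strict_lt R y x by rewrite (rep_strict rep) ry0.
  by have := minx y; move: lt_yx; rewrite /strict_lt => /andP[-> /negbTE->].
by apply/implyP; rewrite (repE rep) lx0 ltn0 orbF.
Qed.

Definition downset R y := [set x | strict_lt R x y].
Definition downsets R := [set downset R y | y : 'I_n].
Definition left_end R y := #|[set A in downsets R | A \proper downset R y]|.
(** The down-sets avoiding [x] form an initial segment of the chain, nonempty because it contains
    the down-set of [x]. The predecessor turns their number into the rank of the last one, ranks
    starting at 0. *)
Definition right_end R x := #|[set A in downsets R | x \notin A]|.-1.

(** If neither down-set contains the other, take [x] below [y] but not [y'], and [x'] below [y'] but
    not [y]. Any comparability between the two chains would put [x] below [y'] or [x'] below [y], so
    they form a 2+2. *)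
Lemma downset_chain R : is_poset R -> two_plus_two_free R ->
  forall y y', (downset R y \subset downset R y') || (downset R y' \subset downset R y).
Proof.
case/and3P=> /forallP refl /forallP anti /forallP trans free y y'.
have tr a b c : R a b -> R b c -> R a c.
  by move=> ab bc; have /forallP/(_ b)/forallP/(_ c) := trans a; rewrite ab bc.
have asym a b : R a b -> R b a -> a = b.
  by move=> ab ba; have /forallP/(_ b) := anti a; rewrite ab ba => /eqP.
have lt_le a b c : strict_lt R a b -> R b c -> strict_lt R a c.
  case/andP=> ab /eqP nab bc; rewrite /strict_lt (tr _ b) //.
  by apply/eqP => eac; apply: nab; apply: asym => //; rewrite eac.
have le_lt a b c : R a b -> strict_lt R b c -> strict_lt R a c.
  move=> ab /andP[bc /eqP nbc]; rewrite /strict_lt (tr _ b) //.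
  by apply/eqP => eac; apply: nbc; apply: asym => //; rewrite -eac.
apply: contraNT free => /norP[/subsetPn[x]] + + /subsetPn[x'].
rewrite !inE => xy nxy' x'y' nx'y.
have nle a b : strict_lt R a b -> R a b by case/andP.
apply/existsP; exists x; apply/existsP; exists y.
apply/existsP; exists x'; apply/existsP; exists y'.
apply/and5P; split=> //; first by apply/andP; split; apply/negP => h;
  [move: nxy' | move: nx'y]; rewrite (le_lt _ _ _ h).
- apply/andP; split; apply/negP => h; last first.
    by move: nx'y; rewrite (lt_le _ _ _ x'y') // (tr _ x) // nle.
  case: (eqVneq x y') => [e|ne]; last by move: nxy'; rewrite /strict_lt h ne.
  by move: nx'y; rewrite (lt_le _ _ _ x'y') // -e nle.
apply/andP; split; apply/andP; split; apply/negP => h.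
- by move: nxy'; rewrite (lt_le _ _ _ xy) // (tr _ x') // nle.
- case: (eqVneq x' y) => [e|ne]; last by move: nx'y; rewrite /strict_lt h ne.
  by move: nxy'; rewrite (lt_le _ _ _ xy) // -e nle.
- by move: nxy'; rewrite (lt_le _ _ _ xy).
- by move: nx'y; rewrite (lt_le _ _ _ x'y').
Qed.

Lemma rep_exists R : is_poset R -> two_plus_two_free R ->
  interval_rep R #|downsets R| (left_end R) (right_end R).
Proof.
move=> poset free; have chain := downset_chain poset free.
set D := downset R; set DD := downsets R; set l := left_end R; set r := right_end R.
have DDD y : D y \in DD by apply: imset_f.
have DDP A : A \in DD -> exists y, A = D y by case/imsetP=> y _ ->; exists y.
have nDxx x : x \notin D x by rewrite inE /strict_lt eqxx andbF.
have proper_lt y y' : D y \proper D y' -> (l y < l y')%N.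
  move=> pr; apply: proper_card; apply/properP; split.
    apply/subsetP => A; rewrite !inE => /andP[-> /=] /proper_trans; exact.
  by exists (D y); rewrite !inE ?DDD ?pr ?properxx ?andbF.
have lt_proper y y' : (l y < l y')%N -> D y \proper D y'.
  move=> lt; have nsub : ~~ (D y' \subset D y).
    apply/negP => sub; move: lt; rewrite ltnNge => /negP; apply.
    apply: subset_leq_card; apply/subsetP => A; rewrite !inE => /andP[-> /=] pr.
    exact: proper_sub_trans pr sub.
  by have := chain y y'; rewrite -/D (negbTE nsub) orbF properE nsub => ->.
have inj y y' : l y = l y' -> D y = D y'.
  move=> e; have := chain y y'; rewrite -/D => /orP[] sub;
    [|apply: esym]; apply/eqP; rewrite eqEproper sub /=;
  by apply/negP => /proper_lt; rewrite e ltnn.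
(* In a chain, the down-sets avoiding [x] are all proper subsets of any down-set containing [x].
   Conversely, if the down-set of [y] avoids [x], so do its subsets, and it is itself one more such
   set. *)
have ltr x y : (x \in D y) = (r x < l y)%N.
  have pos : (0 < #|[set A in DD | x \notin A]|)%N.
    by apply/card_gt0P; exists (D x); rewrite inE DDD nDxx.
  have [xy|nxy] := boolP (x \in D y).
    apply/esym; rewrite /r /right_end prednK //; apply: subset_leq_card.
    apply/subsetP => A; rewrite !inE => /andP[ADD nxA]; rewrite ADD /=.
    have [z ez] := DDP _ ADD; have nsub : ~~ (D y \subset A).
      by apply: contra nxA => /subsetP; apply.
    by have := chain z y; rewrite -/D -ez (negbTE nsub) orbF properE nsub => ->.
  apply/esym/negbTE; rewrite -leqNgt -ltnS /r /right_end prednK //.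
  apply: proper_card; apply/properP; split; last first.
    by exists (D y); rewrite inE ?properxx ?andbF // DDD.
  apply/subsetP => A; rewrite !inE => /andP[-> /=] /proper_sub/subsetP sub.
  by apply: contra nxy => /sub.
have lem y : (l y < #|DD|)%N.
  apply: proper_card; apply/properP; split.
    by apply/subsetP => A; rewrite inE => /andP[].
  by exists (D y); rewrite ?inE ?DDD ?properxx ?andbF.
have lr x : (l x <= r x)%N by rewrite leqNgt -ltr.
have rm x : (r x < #|DD|)%N.
  rewrite /r /right_end prednK; last by apply/card_gt0P; exists (D x); rewrite inE DDD nDxx.
  by apply: subset_leq_card; apply/subsetP => A; rewrite inE => /andP[].
(* The rank is injective from the down-sets to ['I_#|DD|], so by cardinality it is onto. The default
   of [insubd] is never taken on a down-set, by [lem]. *)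
have lsurj i : (i < #|DD|)%N -> exists x, l x = i.
  move=> lti;
  pose f (A : {set 'I_n}) : 'I_#|DD| :=
    insubd (Ordinal lti) #|[set B in DD | B \proper A]|.
  have fD y : f (D y) = l y :> nat by rewrite /f insubdK ?unfold_in ?lem.
  have finj : {in DD &, injective f}.
    move=> A B /DDP[y ->] /DDP[y' ->] e; apply: inj.
    by rewrite -!fD e.
  have : f @: DD = setT.
    by apply/eqP; rewrite eqEcard subsetT (card_in_imset finj) cardsT card_ord leqnn.
  move/setP/(_ (Ordinal lti)); rewrite inE => /imsetP[A /DDP[y ->]] e.
  by exists y; rewrite -fD -e.
split=> // [i lti|x y].
  have [y ly] := lsurj _ lti.
  (* For the last index, [y] itself has right endpoint [i]. Otherwise any element of the down-set of
     rank [i.+1] outside the one of rank [i] does. *)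
  have [ltSi|] := ltnP i.+1 #|DD|; last first.
    by move=> le; exists y; have := lr y; have := rm y; rewrite ly; lia.
  have [y' ly'] := lsurj _ ltSi.
  have /properP[_ [x xy' nxy]] : D y \proper D y' by apply: lt_proper; rewrite ly ly'.
  by exists x; move: xy' nxy; rewrite !ltr ly ly'; lia.
rewrite -ltr inE /strict_lt; case: eqVneq => [->|_]; last by rewrite andbT.
by case/and3P: poset => /forallP ->.
Qed.

End IntervalRepresentation.

(** Both images are projections of the image under the pair map, and the hypothesis makes both
    projections injective. *)
Lemma card_imset_ext (aT rT rT' : finType) (f : aT -> rT) (g : aT -> rT') (P : {set aT}) :
  {in P &, forall x y, f x = f y <-> g x = g y} -> #|f @: P| = #|g @: P|.
Proof.
move=> fg; pose h x := (f x, g x).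
have [cf cg] : #|fst @: (h @: P)| = #|h @: P| /\ #|snd @: (h @: P)| = #|h @: P|.
  by split; apply: card_in_imset => _ _ /imsetP[x Px ->] /imsetP[y Py ->] /= e;
    congr (_, _) => //; apply/fg.
by rewrite -cf in cg; rewrite -!imset_comp in cg; exact: esym cg.
Qed.

(** Equal fiber sizes say that the two tuples of values are rearrangements of each other. *)
Lemma perm_of_fibers n (T : eqType) (f g : 'I_n -> T) :
  (forall p, #|[set x | f x == p]| = #|[set x | g x == p]|) ->
  exists s : {perm 'I_n}, forall x, f x = g (s x).
Proof.
move=> fg; have : perm_eq [tuple f x | x < n] [tuple g x | x < n].
  apply/allP => p _ /=; apply/eqP.
  have cE (h : 'I_n -> T) : count_mem p [tuple h x | x < n] = #|[set x | h x == p]|.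
    by rewrite /= count_map cardsE cardE size_filter enumT.
  by rewrite !cE.
case/tuple_permP => s e; exists s => x.
have := congr1 (fun t : seq T => nth (f x) t x) e.
by rewrite -!tnth_nth !tnth_mktuple.
Qed.

(** * Isomorphism classes as matrices of endpoint counts *)

Definition fiber n (l r : 'I_n -> nat) (i j : nat) : nat :=
  #|[set x | (l x == i) && (r x == j)]|.

Lemma sum_fiber n (l r : 'I_n -> nat) m (P : pred nat) :
  (forall x, l x < m)%N -> (forall x, r x < m)%N ->
  (\sum_(i < m | P i) \sum_(j < m) fiber l r i j)%N = #|[set x | P (l x)]|.
Proof.
move=> lm rm.
transitivity (\sum_x \sum_(i < m | P i) \sum_(j < m) ((l x == i) && (r x == j) : nat))%N.
  rewrite [RHS]exchange_big; apply: eq_bigr => i _ /=.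
  rewrite [RHS]exchange_big; apply: eq_bigr => j _ /=.
  by rewrite /fiber cardsE -sum1_card big_mkcond.
rewrite -sum1_card [RHS]big_mkcond; apply: eq_bigr => x _ /=.
rewrite inE big_mkcond (bigD1 (Ordinal (lm x))) //= [X in (_ + X)%N]big1 ?addn0; last first.
  move=> i /eqP ne; case: ifP => // _; apply: big1 => j _.
  by case: eqP => // e; case: ne; apply: val_inj.
case: (P _) => //; rewrite (bigD1 (Ordinal (rm x))) //= big1 ?eqxx //.
by move=> j /eqP ne; case: (r x =P j) => [e|]; rewrite ?andbF //; case: ne; apply: val_inj.
Qed.

(** Bounding size and entries by [n] loses nothing for posets on [n] elements and makes the codes a
    finite type. *)
Definition mxcode (n : nat) := {m : 'I_n.+1 & 'M['I_n.+1]_m}.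

Definition mk_mxcode n (m : nat) (F : nat -> nat -> nat) : mxcode n :=
  Tagged (fun m : 'I_n.+1 => 'M['I_n.+1]_m)
    (\matrix_(i, j) inord (F i j) : 'M_(inord m : 'I_n.+1)).

(** The value 0 outside the matrix lets equal codes yield equal fibers at all pairs of numbers,
    without casts between matrix sizes. *)
Definition mxentry n (c : mxcode n) (i j : nat) : nat :=
  if (insub i, insub j) is (Some i', Some j') then tagged c i' j' else 0.

Lemma mxentry_mk n m F i j : (m <= n)%N -> (F i j <= n)%N ->
  mxentry (mk_mxcode n m F) i j = if (i < m)%N && (j < m)%N then F i j else 0.
Proof.
move=> mn Fn; rewrite /mxentry /=.
case: insubP => [i' _ ei|]; last first.
  by rewrite inordK // => /negbTE->.
have -> : (i < m)%N by have := ltn_ord i'; rewrite ei inordK.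
case: insubP => [j' _ ej|]; last first.
  by rewrite inordK // => /negbTE->.
have -> : (j < m)%N by have := ltn_ord j'; rewrite ej inordK.
by rewrite mxE ei ej inordK.
Qed.

Lemma mk_mxcodeE n (c : mxcode n) (F : nat -> nat -> nat) :
  (forall i j : 'I_(tag c), F i j = tagged c i j) -> mk_mxcode n (tag c) F = c.
Proof.
case: c => m N /= FN; rewrite /mk_mxcode; move: (inord_val m).
(* The size [inord m] equals [m] only propositionally, so it is generalized and the equation
   eliminated before the matrices are compared. *)
set m' := inord m; move: m' => m' e; case: _ / (esym e) N FN => N FN.
congr (Tagged _ _); apply/matrixP => i j; rewrite mxE FN inord_val //.
Qed.

Definition fishburn_code n k (c : mxcode n) : bool :=
  let: N := \matrix_(i, j) (tagged c i j : nat) in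
  [&& fishburn (map_mx (fun e => e != 0)%N N),
      \sum_i \sum_j N i j == n & \sum_(i < tag c | i == 0 :> nat) \sum_j N i j == k]%N.

Section Coding.

Variables (n k : nat).
Implicit Types (R : relI n) (l r : 'I_n -> nat).

Definition poset_code R : mxcode n :=
  mk_mxcode n #|downsets R| (fiber (left_end R) (right_end R)).

(** By uniqueness, the code can be read off any representation, in particular one transported along
    an isomorphism. *)
Lemma poset_code_rep R m l r :
  interval_rep R m l r -> poset_code R = mk_mxcode n m (fiber l r).
Proof.
move=> rep; have rep' := rep_exists (rep_poset rep) (rep_free rep).
have [<- el er] := rep_unique rep' rep; congr (Tagged _ _).
apply/matrixP => i j; rewrite !mxE; congr inord.
by apply: eq_card => x; rewrite !inE el er.
Qed.

Lemma rep_size R m l r : interval_rep R m l r -> (m <= n)%N.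
Proof.
move=> rep; have rep' := rep_exists (rep_poset rep) (rep_free rep).
have [<- _ _] := rep_unique rep' rep.
by rewrite -[leqRHS]card_ord; apply: leq_imset_card.
Qed.

Lemma fiber_le l r i j : (fiber l r i j <= n)%N.
Proof. by rewrite -[leqRHS]card_ord; apply: max_card. Qed.

Lemma mxentry_rep R m l r i j :
  interval_rep R m l r -> mxentry (mk_mxcode n m (fiber l r)) i j = fiber l r i j.
Proof.
move=> rep; rewrite mxentry_mk ?(rep_size rep) ?fiber_le //; case: ifP => // /negP nlt.
apply/esym/eqP; rewrite cards_eq0; apply/eqP/setP => x; rewrite !inE.
apply/negP => /andP[/eqP lx /eqP rx]; apply: nlt.
by rewrite -lx -rx (rep_ltm rep) (leq_ltn_trans (rep_le rep x)) // (rep_ltm rep).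
Qed.

Lemma rel_isoP R R' :
  reflect (exists s : {perm 'I_n}, forall x y, R x y = R' (s x) (s y)) (rel_iso R R').
Proof.
apply: (iffP existsP) => -[s] => [/andP[_ /forallP iso]|iso]; exists s.
  by move=> x y; have /forallP/(_ y)/eqP := iso x.
by rewrite inE; apply/forallP => x; apply/forallP => y; apply/eqP.
Qed.

(** An isomorphism transports a representation of [R'] to one of [R] with the same fibers.
    Conversely, equal fibers give a permutation matching both endpoints, and the endpoints determine
    the order. *)
Lemma rel_iso_code R R' m m' l l' r r' :
  interval_rep R m l r -> interval_rep R' m' l' r' ->
  rel_iso R R' <-> poset_code R = poset_code R'.
Proof.
move=> rep rep'; split=> [/rel_isoP[s iso]|].
  have reps : interval_rep R m' (l' \o s) (r' \o s).
    case: rep' => le lt left right RE; split=> //= [i /left[x <-]|i /right[x <-]|x y].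
    - by exists (s^-1%g x); rewrite permKV.
    - by exists (s^-1%g x); rewrite permKV.
    by rewrite iso RE (inj_eq perm_inj).
  rewrite (poset_code_rep reps) (poset_code_rep rep'); congr (Tagged _ _).
  apply/matrixP => i j; rewrite !mxE; congr inord; rewrite /fiber.
  rewrite -[RHS](card_preimset _ (@perm_inj _ s)).
  by apply: eq_card => x; rewrite !inE.
rewrite (poset_code_rep rep) (poset_code_rep rep') => e.
have fib i j : fiber l r i j = fiber l' r' i j.
  by rewrite -(mxentry_rep i j rep) e (mxentry_rep i j rep').
have [s sE] : exists s : {perm 'I_n}, forall x, (l x, r x) = (l' (s x), r' (s x)).
  by apply: (@perm_of_fibers n _ (fun x => (l x, r x)) (fun x => (l' x, r' x))) => -[i j];
    apply: fib.
apply/rel_isoP; exists s => x y; rewrite (repE rep) (repE rep') (inj_eq perm_inj).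
by have [_ ->] := sE x; have [-> _] := sE y.
Qed.

Lemma p22_eq_card_code : p22 n k = #|[set poset_code R | R in P22 n k]|.
Proof.
apply: card_imset_ext => R R'; rewrite !inE.
case/and3P=> poset free _ /and3P[poset' free' _].
have rep := rep_exists poset free; have rep' := rep_exists poset' free'.
rewrite -(rel_iso_code rep rep'); split=> [e|/rel_isoP[s iso]].
  have : R' \in [set Q | rel_iso R' Q].
    by rewrite inE; apply/rel_isoP; exists 1%g => x y; rewrite !perm1.
  by rewrite -e inE.
apply/setP => Q; rewrite !inE; apply/rel_isoP/rel_isoP => -[s' iso'].
  by exists (s^-1 * s')%g => x y; rewrite !permM -iso' iso !permKV.
by exists (s * s')%g => x y; rewrite !permM -iso' iso.
Qed.

Lemma poset_code_fishburn R : R \in P22 n k -> fishburn_code k (poset_code R).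
Proof.
rewrite inE => /and3P[poset free /eqP mink].
have rep := rep_exists poset free; move: rep mink.
set m := #|_|; move: (left_end R) (right_end R) => l r rep mink.
rewrite (poset_code_rep rep).
have Em : (inord m : 'I_n.+1) = m :> nat by rewrite inordK // ltnS (rep_size rep).
have lm x : (l x < (inord m : 'I_n.+1))%N.
  by rewrite Em; apply: leq_ltn_trans (rep_le rep x) (rep_ltm rep x).
have rm x : (r x < (inord m : 'I_n.+1))%N by rewrite Em (rep_ltm rep).
have NE (i j : 'I_(inord m : 'I_n.+1)) :
    (tagged (mk_mxcode n m (fiber l r)) i j : nat) = fiber l r i j.
  by rewrite mxE inordK // ltnS fiber_le.
have pos x : (0 < fiber l r (l x) (r x))%N.
  by apply/card_gt0P; exists x; rewrite inE !eqxx.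
apply/and3P; split.
- apply/fishburnP; split=> [i j|i|j].
  + rewrite mxE mxE NE -lt0n => /card_gt0P[x]; rewrite inE => /andP[/eqP<- /eqP<-].
    exact: rep_le rep x.
  + have [x lx] := rep_left rep (leq_trans (ltn_ord i) (eq_leq Em)).
    by exists (Ordinal (rm x)); rewrite mxE mxE NE -lt0n -lx; apply: pos.
  + have [x rx] := rep_right rep (leq_trans (ltn_ord j) (eq_leq Em)).
    by exists (Ordinal (lm x)); rewrite mxE mxE NE -lt0n -rx; apply: pos.
- under eq_bigr do under eq_bigr do rewrite mxE NE.
  by rewrite (sum_fiber predT lm rm) /= cardsE card_ord.
under eq_bigr do under eq_bigr do rewrite mxE NE.
by rewrite (sum_fiber (pred1 0%N) lm rm) -mink (rep_num_minimal rep).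
Qed.

Lemma card_nth (T : eqType) (x0 : T) (t : seq T) (P : pred T) : size t = n ->
  #|[set x : 'I_n | P (nth x0 t x)]| = count P t.
Proof.
move=> tn; rewrite -sum1_card -sum1_count (big_nth x0) tn big_mkord.
by apply: eq_bigl => x; rewrite inE.
Qed.

(** The list [t] repeats each pair [(i, j)] as often as [N i j] says. It has length [n], and its
    entries serve as the intervals of the [n] elements. Nonzero rows and columns ensure that every
    index is a left and a right endpoint. *)
Lemma fishburn_code_poset c : fishburn_code k c ->
  exists2 R, R \in P22 n k & poset_code R = c.
Proof.
case: c => m N /and3P[/fishburnP /= [up rows cols] /eqP Nn /eqP Nk].
pose t := flatten [seq nseq (N p.1 p.2) (p.1 : nat, p.2 : nat) | p <- enum {: 'I_m * 'I_m}].
have countE (a : pred (nat * nat)) :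
    count a t = (\sum_(p : 'I_m * 'I_m) a (p.1 : nat, p.2 : nat) * N p.1 p.2)%N.
  rewrite count_flatten -map_comp sumnE big_map big_enum /=.
  by apply: eq_bigr => p _; rewrite count_nseq.
have tn : size t = n.
  rewrite -count_predT countE -{}[RHS]Nn pair_bigA /=.
  by apply: eq_bigr => p _; rewrite mul1n mxE.
pose l (x : 'I_n) := (nth (0, 0)%N t x).1; pose r (x : 'I_n) := (nth (0, 0)%N t x).2.
have fibN (i j : 'I_m) : fiber l r i j = N i j.
  rewrite /fiber (@card_nth _ (0, 0)%N t (fun p => (p.1 == i) && (p.2 == j))%N) // countE.
  rewrite (bigD1 (i, j)) //= !eqxx mul1n big1 ?addn0 // => -[i' j'] /= ne.
  case: eqP => // ei; case: eqP => // ej; case/eqP: ne.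
  by congr (_, _); apply: val_inj.
have tP (x : 'I_n) : exists i j : 'I_m, [/\ l x = i, r x = j & N i j != 0 :> nat].
  have : nth (0, 0)%N t x \in t by apply: mem_nth; rewrite tn.
  case/flatten_mapP => -[i j] _ /=; rewrite mem_nseq => /andP[Nij /eqP e].
  by exists i, j; rewrite /l /r e -lt0n.
have ex (i j : 'I_m) : N i j != 0 :> nat -> exists x, l x = i /\ r x = j.
  rewrite -fibN -lt0n => /card_gt0P[x]; rewrite inE => /andP[/eqP lx /eqP rx].
  by exists x.
pose R : relI n := [ffun x => [ffun y => (x == y) || (r x < l y)%N]].
have rep : interval_rep R m l r.
  split.
  - by move=> x; have [i [j [-> -> Nij]]] := tP x; apply: up; rewrite !mxE.
  - by move=> x; have [i [j [_ -> _]]] := tP x.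
  - move=> i ltim; have [j] := rows (Ordinal ltim); rewrite !mxE => /ex[x [lx _]].
    by exists x.
  - move=> j ltjm; have [i] := cols (Ordinal ltjm); rewrite !mxE => /ex[x [_ rx]].
    by exists x.
  - by move=> x y; rewrite !ffunE.
have lm x : (l x < m)%N := leq_ltn_trans (rep_le rep x) (rep_ltm rep x).
exists R; last first.
  rewrite (poset_code_rep rep); apply: (@mk_mxcodeE n (Tagged _ N)) => i j; exact: fibN.
rewrite inE (rep_poset rep) (rep_free rep) (rep_num_minimal rep) -Nk /=.
rewrite -(sum_fiber (pred1 0%N) lm (rep_ltm rep)); apply/eqP.
by apply: eq_bigr => i _; apply: eq_bigr => j _; rewrite mxE fibN.
Qed.

Lemma p22_eq_card_fishburn : p22 n k = #|[set c : mxcode n | fishburn_code k c]|.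
Proof.
rewrite p22_eq_card_code; apply: eq_card => c; rewrite inE.
apply/imsetP/idP => [[R RP ->]|/fishburn_code_poset[R RP <-]].
  exact: poset_code_fishburn.
by exists R.
Qed.

End Coding.

(** * The ring of bivariate formal power series *)

(** This reduces associativity and commutativity, one coefficient at a time, to polynomial
    truncations, where they hold in [{poly {poly int}}]. *)
Lemma fps_mul_local (n k : nat) (f f' g g' : fps) :
  (forall i j, (i <= n)%N -> (j <= k)%N -> f i j = f' i j) ->
  (forall i j, (i <= n)%N -> (j <= k)%N -> g i j = g' i j) ->
  fps_mul f g n k = fps_mul f' g' n k.
Proof.
move=> ff gg; apply: eq_bigr => i _; apply: eq_bigr => j _.
by rewrite ff ?gg ?leq_subr // -ltnS.
Qed.

(** The outer variable is [t], the inner one [z]. *)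
Definition coef2 (p : {poly {poly int}}) : fps := fun n k => p`_n`_k.

Definition trunc2 (n k : nat) (f : fps) : {poly {poly int}} :=
  \poly_(i < n.+1) \poly_(j < k.+1) f i j.

Lemma coef2_trunc (n k : nat) (f : fps) i j :
  (i <= n)%N -> (j <= k)%N -> coef2 (trunc2 n k f) i j = f i j.
Proof. by move=> le_in le_jk; rewrite /coef2 !coef_poly !ltnS le_in coef_poly ltnS le_jk. Qed.

Lemma coef2M p q : coef2 (p * q) = fps_mul (coef2 p) (coef2 q).
Proof.
apply/funext => n; apply/funext => k; rewrite /coef2 /fps_mul coefM coef_sum.
by apply: eq_bigr => i _; rewrite coefM.
Qed.

Lemma coef2_1 : coef2 1 = fps_one.
Proof.
apply/funext => n; apply/funext => k; rewrite /coef2 /fps_one /fps_const coef1.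
by case: n => [|n]; rewrite ?coef1 ?coef0 //=; case: k.
Qed.

Lemma fps_mulA : associative fps_mul.
Proof.
move=> f g h; apply/funext => n; apply/funext => k.
pose F := trunc2 n k f; pose G := trunc2 n k g; pose H := trunc2 n k h.
have tr (e : fps) i j : (i <= n)%N -> (j <= k)%N -> e i j = coef2 (trunc2 n k e) i j.
  by move=> ? ?; rewrite coef2_trunc.
have trM (e e' : fps) i j : (i <= n)%N -> (j <= k)%N ->
    fps_mul e e' i j = coef2 (trunc2 n k e * trunc2 n k e') i j.
  move=> lein lejk; rewrite coef2M; apply: fps_mul_local => i' j' ? ?;
  by apply: tr; [apply: leq_trans lein | apply: leq_trans lejk].
rewrite (fps_mul_local (tr f) (trM g h)) (fps_mul_local (trM f g) (tr h)).
by rewrite -!coef2M mulrA.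
Qed.

Lemma fps_mulC : commutative fps_mul.
Proof.
move=> f g; apply/funext => n; apply/funext => k.
have tr (e : fps) i j : (i <= n)%N -> (j <= k)%N -> e i j = coef2 (trunc2 n k e) i j.
  by move=> ? ?; rewrite coef2_trunc.
by rewrite (fps_mul_local (tr f) (tr g)) (fps_mul_local (tr g) (tr f)) -!coef2M mulrC.
Qed.

Lemma fps_mul1 : left_id fps_one fps_mul.
Proof.
move=> f; apply/funext => n; apply/funext => k.
rewrite -coef2_1 (@fps_mul_local _ _ _ (coef2 1) _ (coef2 (trunc2 n k f))) //; last first.
  by move=> i j ? ?; rewrite coef2_trunc.
by rewrite -coef2M mul1r coef2_trunc.
Qed.

Lemma fps_mulDl : left_distributive fps_mul fps_add.
Proof.
move=> f g h; apply/funext => n; apply/funext => k; rewrite /fps_mul /fps_add -big_split.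
apply: eq_bigr => i _; rewrite -big_split; apply: eq_bigr => j _; exact: mulrDl.
Qed.

Lemma fps_addA : associative fps_add.
Proof. by move=> f g h; apply/funext => n; apply/funext => k; apply: addrA. Qed.

Lemma fps_addC : commutative fps_add.
Proof. by move=> f g; apply/funext => n; apply/funext => k; apply: addrC. Qed.

Lemma fps_add0 : left_id (fps_const 0) fps_add.
Proof.
by move=> f; apply/funext => n; apply/funext => k; rewrite /fps_add /fps_const if_same add0r.
Qed.

Lemma fps_addN : left_inverse (fps_const 0) fps_opp fps_add.
Proof.
move=> f; apply/funext => n; apply/funext => k.
by rewrite /fps_add /fps_opp /fps_const if_same addNr.
Qed.

HB.instance Definition _ := gen_eqMixin fps.
HB.instance Definition _ := gen_choiceMixin fps.
HB.instance Definition _ :=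
  GRing.isZmodule.Build fps fps_addA fps_addC fps_add0 fps_addN.

Lemma fps_one_neq0 : fps_one != fps_const 0 :> fps.
Proof. by apply/eqP => /(congr1 (fun f : fps => f 0%N 0%N)). Qed.

HB.instance Definition _ :=
  GRing.Zmodule_isComNzRing.Build fps fps_mulA fps_mulC fps_mul1 fps_mulDl fps_one_neq0.

Lemma fps0E n k : (0 : fps) n k = 0. Proof. exact: if_same. Qed.
Lemma fpsDE (f g : fps) n k : (f + g) n k = f n k + g n k. Proof. by []. Qed.
Lemma fpsNE (f : fps) n k : (- f) n k = - f n k. Proof. by []. Qed.

Lemma fps_sumE (I : Type) (s : seq I) (P : pred I) (F : I -> fps) n k :
  (\sum_(i <- s | P i) F i) n k = \sum_(i <- s | P i) F i n k.
Proof.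
exact: (big_morph (fun f : fps => f n k) (fun f g => fpsDE f g n k) (fps0E n k)).
Qed.

Lemma fps_powE (f : fps) m : fps_pow f m = f ^+ m.
Proof. by elim: m => [//|m IHm]; rewrite exprS -IHm. Qed.

Lemma fps_sum_bigE s (F : nat -> fps) : fps_sum s F = \sum_(i <- s) F i.
Proof. by elim: s => [|i s IHs]; rewrite ?big_nil ?big_cons // -IHs. Qed.

Lemma fps_prod_bigE s (F : nat -> fps) : fps_prod s F = \prod_(i <- s) F i.
Proof. by elim: s => [|i s IHs]; rewrite ?big_nil ?big_cons // -IHs. Qed.

(** The index (0,0) being excluded, each recursive call lowers [n + k], so extra fuel changes
    nothing. *)
Lemma fps_inv_aux_fuel (f : fps) d n k : (n + k <= d)%N ->
  fps_inv_aux f d n k = fps_inv f n k.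
Proof.
rewrite /fps_inv; elim/ltn_ind: d n k => -[|d] IHd n k le_nkd.
  by move: le_nkd; rewrite leqn0 => /eqP->.
case e: (n + k)%N le_nkd => [|p] le_nkd.
  by move/eqP: e; rewrite addn_eq0 /= => /andP[/eqP-> /eqP->].
rewrite /=; case: ifP => // _; congr (- _).
apply: eq_bigr => i _; apply: eq_bigr => j _; case: ifP => // nz.
have lt : (n - i + (k - j) <= p)%N.
  by have := ltn_ord i; have := ltn_ord j; lia.
by rewrite !IHd // (leq_trans lt).
Qed.

(** The recursion for [fps_inv] is the vanishing of the coefficient of the product at each [(n, k)]
    other than (0,0), solved for the term carrying [f 0 0 = 1]. *)
Lemma fps_mulVf (f : fps) : f 0%N 0%N = 1 -> f * fps_inv f = 1.
Proof.
move=> f00; apply/funext => n; apply/funext => k.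
change (fps_mul f (fps_inv f) n k = fps_one n k); rewrite /fps_mul.
rewrite big_ord_recl big_ord_recl /= f00 mul1r !subn0.
case e: (n + k)%N => [|p].
  move/eqP: e; rewrite addn_eq0 /= => /andP[/eqP-> /eqP->].
  by rewrite !big_ord0 !addr0.
have nz : (n == 0%N) && (k == 0%N) = false by rewrite -addn_eq0 e.
rewrite /fps_one /fps_const nz {1}/fps_inv e /= nz.
rewrite big_ord_recl big_ord_recl /= add0r !subn0.
apply/eqP; rewrite -addrA addrC subr_eq0; apply/eqP; congr (_ + _).
  apply: eq_bigr => j _; rewrite fps_inv_aux_fuel ?subn0 //.
  by move: (ltn_ord j); rewrite /bump; lia.
apply: eq_bigr => i _; apply: eq_bigr => j _; rewrite fps_inv_aux_fuel //.
by have := ltn_ord i; have := ltn_ord j; rewrite /bump; lia.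
Qed.

(** * The functional equation *)

(* [t ^ N] divides [f] *)
Definition tdvd (N : nat) (f : fps) := forall n k, (n < N)%N -> f n k = 0.

Lemma tdvd0 N : tdvd N 0.
Proof. by move=> n k _; rewrite fps0E. Qed.

Lemma tdvdW N N' f : (N <= N')%N -> tdvd N' f -> tdvd N f.
Proof. by move=> leN f0 n k ltn; rewrite f0 // (leq_trans ltn). Qed.

Lemma tdvdD N f g : tdvd N f -> tdvd N g -> tdvd N (f + g).
Proof. by move=> f0 g0 n k ltn; rewrite fpsDE f0 ?g0. Qed.

Lemma tdvdN N f : tdvd N f -> tdvd N (- f).
Proof. by move=> f0 n k ltn; rewrite fpsNE f0 ?oppr0. Qed.

Lemma tdvdM N N' f g : tdvd N f -> tdvd N' g -> tdvd (N + N') (f * g).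
Proof.
move=> f0 g0 n k ltn; change (fps_mul f g n k = 0).
apply: big1 => i _; apply: big1 => j _.
have [ltiN|leNi] := ltnP i N; first by rewrite f0 ?mul0r.
by move: (ltn_ord i) => ltin; rewrite g0 ?mulr0 //; lia.
Qed.

Lemma tdvdMl N f g : tdvd N g -> tdvd N (f * g).
Proof. by move=> g0; rewrite -[N]add0n; apply: tdvdM. Qed.

Lemma tdvdMr N f g : tdvd N f -> tdvd N (f * g).
Proof. by move=> f0; rewrite mulrC; apply: tdvdMl. Qed.

Lemma tdvd_sum N (I : Type) (s : seq I) (P : pred I) (F : I -> fps) :
  (forall i, P i -> tdvd N (F i)) -> tdvd N (\sum_(i <- s | P i) F i).
Proof. by move=> F0; apply: big_ind => //; [apply: tdvd0 | move=> *; apply: tdvdD]. Qed.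

Lemma tdvd_prodB N (I : Type) (s : seq I) (P : pred I) (F G : I -> fps) :
  (forall i, P i -> tdvd N (F i - G i)) ->
  tdvd N (\prod_(i <- s | P i) F i - \prod_(i <- s | P i) G i).
Proof.
move=> FG; apply: (big_ind2 (fun f g => tdvd N (f - g))) => //.
  by rewrite subrr; apply: tdvd0.
move=> f f' g g' ff gg.
rewrite (_ : _ - _ = (f - f') * g + f' * (g - g')); last by ring.
by apply: tdvdD; [apply: tdvdMr | apply: tdvdMl].
Qed.

Lemma tdvd_t : tdvd 1 fps_t.
Proof. by case. Qed.

Section FunctionalEquation.

Variables X T v w : fps.
Hypotheses (vK : (1 - X) * v = 1) (wK : (1 - T) * w = 1).
Hypotheses (X1 : tdvd 1 X) (T1 : tdvd 1 T).

Let q := 1 - T.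
(** The index [j] stands for the argument [q ^+ j * (1 - X)] of the functional equation, so that
    shifting [j] replaces substitution into a series. *)
Let V j := (1 - X) * q ^+ j.
Let Vi j := v * w ^+ j.

(* The recursion of [fishburn_gfSS], for [u = Vi j - 1] and [s = w - 1]. *)
Fixpoint split_iter m j : fps :=
  if m is m'.+1 then (Vi j - 1) * (split_iter m' j.+1 - split_iter m' j) else Vi j - 1.

(** The q-Pochhammer symbol (q; q)_m at q = 1 - T. *)
Definition qpoch m : fps := \prod_(i <- iota 1 m) (1 - q ^+ i).

Let split_sum M j := 1 + \sum_(m < M) split_iter m j.
(** The truncated right-hand side of the theorem, with [1 - V j] in place of [X]; the two agree at
    [j = 0]. *)
Let closed_sum M j := 1 + \sum_(m < M) (1 - V j) * Vi j ^+ m.+1 * qpoch m.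

Lemma V_Vi j : V j * Vi j = 1.
Proof.
rewrite /V /Vi (_ : _ * _ = ((1 - X) * v) * (q * w) ^+ j); last by rewrite exprMn; ring.
by rewrite vK wK expr1n mulr1.
Qed.

Lemma tdvd_1subV j : tdvd 1 (1 - V j).
Proof.
elim: j => [|j IHj]; first by rewrite /V expr0 mulr1 opprB addrC subrK.
rewrite (_ : _ - _ = (1 - V j) + V j * T); last by rewrite /V exprS /q; ring.
by apply: tdvdD => //; apply: tdvdMl.
Qed.

Lemma tdvd_Vi_sub1 j : tdvd 1 (Vi j - 1).
Proof.
rewrite (_ : _ - 1 = (1 - V j) * Vi j); last by rewrite mulrBl V_Vi mul1r.
by apply: tdvdMr; apply: tdvd_1subV.
Qed.

Lemma tdvd_split_iter m j : tdvd m.+1 (split_iter m j).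
Proof.
elim: m j => [|m IHm] j; first exact: tdvd_Vi_sub1.
rewrite /= -[m.+2]add1n; apply: tdvdM; first exact: tdvd_Vi_sub1.
by apply: tdvdD => //; apply: tdvdN.
Qed.

Lemma qpochS m : qpoch m.+1 = qpoch m * (1 - q ^+ m.+1).
Proof. by rewrite /qpoch -[m.+1]addn1 iotaD big_cat big_seq1 add1n addn1. Qed.

Lemma tdvd_1subqX i : tdvd 1 (1 - q ^+ i).
Proof.
elim: i => [|i IHi]; first by rewrite expr0 subrr; apply: tdvd0.
rewrite (_ : _ - _ = (1 - q ^+ i) + q ^+ i * T); last by rewrite exprS /q; ring.
by apply: tdvdD => //; apply: tdvdMl.
Qed.

Lemma tdvd_qpoch m : tdvd m (qpoch m).
Proof.
elim: m => [//|m IHm]; rewrite qpochS -addn1.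
by apply: tdvdM => //; apply: tdvd_1subqX.
Qed.

(** Summing the recursion of [split_iter] gives an equation with factor [Vi j - 1], and multiplying
    by [V j] turns this factor into [1 - V j]. The last term is the truncation error. *)
Lemma split_sum_eq M j :
  split_sum M j = 1 + (1 - V j) * split_sum M j.+1 - V j * split_iter M j.
Proof.
have sum_rec : split_sum M j + split_iter M j =
    1 + (Vi j - 1) + (Vi j - 1) * (split_sum M j.+1 - split_sum M j).
  rewrite (_ : _ + _ = split_sum M.+1 j); last by rewrite /split_sum big_ord_recr /= addrA.
  rewrite /split_sum big_ord_recl /= -[RHS]addrA; congr (_ + (_ + _)).
  rewrite [RHS]mulrC opprD addrACA subrr add0r -sumrB mulr_suml.
  by apply: eq_bigr => i _; rewrite mulrC.
apply/eqP; rewrite -subr_eq0; apply/eqP.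
transitivity (V j * (split_sum M j + split_iter M j -
    (1 + (Vi j - 1) + (Vi j - 1) * (split_sum M j.+1 - split_sum M j)))
  + (V j * Vi j - 1) * (1 + split_sum M j.+1 - split_sum M j)); first by ring.
by rewrite sum_rec V_Vi !subrr mulr0 mul0r addr0.
Qed.

(** As [V j.+1 * Vi j.+1 = 1] and [q * Vi j.+1 = Vi j], the summand of index [m] equals
    [Vi j ^+ m.+1 * qpoch m] plus the difference of [Vi j.+1 ^+ i * qpoch i] between [i = m.+1] and
    [i = m], which telescopes. *)
Lemma closed_sum_shift M j :
  closed_sum M j.+1 = \sum_(m < M) Vi j ^+ m.+1 * qpoch m + Vi j.+1 ^+ M * qpoch M.
Proof.
have VV : V j.+1 * Vi j.+1 = 1 := V_Vi j.+1.
have qV : q * Vi j.+1 = Vi j.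
  rewrite /Vi exprS; transitivity ((q * w) * (v * w ^+ j)); first by ring.
  by rewrite wK mul1r.
elim: M => [|M IHM].
  by rewrite /closed_sum !big_ord0 expr0 mul1r addr0 add0r /qpoch /= big_nil.
rewrite /closed_sum big_ord_recr /= addrA -/(closed_sum M j.+1) IHM big_ord_recr /= -!addrA.
congr (_ + _).
have VVM : V j.+1 * Vi j.+1 ^+ M.+1 = Vi j.+1 ^+ M by rewrite exprS mulrA VV mul1r.
by rewrite qpochS -qV [(q * _) ^+ _]exprMn [(1 - V j.+1) * _]mulrBl VVM; ring.
Qed.

Lemma closed_sum_eq M j :
  closed_sum M j = 1 + (1 - V j) * (closed_sum M j.+1 - Vi j.+1 ^+ M * qpoch M).
Proof.
rewrite closed_sum_shift addrK mulr_sumr; congr (_ + _).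
by apply: eq_bigr => m _; rewrite mulrA.
Qed.

(* [split_sum M] and [closed_sum M] both solve [H j = 1 + (1 - V j) * H j.+1]
   modulo [t ^ M], and iterating this equation determines [H] since [t] divides [1 - V j]. *)
Lemma split_iter_sum M :
  tdvd M (\sum_(m < M) split_iter m 0 - \sum_(m < M) X * v ^+ m.+1 * qpoch m).
Proof.
have E j : tdvd M (split_sum M j - closed_sum M j -
    (1 - V j) * (split_sum M j.+1 - closed_sum M j.+1)).
  rewrite (split_sum_eq M j) (closed_sum_eq M j) (_ : _ - _ =
     (1 - V j) * Vi j.+1 ^+ M * qpoch M - V j * split_iter M j); last by ring.
  apply: tdvdD; first by apply: tdvdMl; apply: tdvd_qpoch.
  by apply: tdvdN; apply: tdvdMl; exact: tdvdW (leqnSn M) (@tdvd_split_iter M j).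
have D i j : (i <= M)%N -> tdvd i (split_sum M j - closed_sum M j).
  elim: i j => [//|i IHi] j ltiM.
  rewrite -[_ - _](subrK ((1 - V j) * (split_sum M j.+1 - closed_sum M j.+1))).
  apply: tdvdD; first exact: tdvdW ltiM (E j).
  by rewrite -add1n; apply: tdvdM; [apply: tdvd_1subV | apply: IHi; apply: ltnW].
have := D M 0 (leqnn M); rewrite /split_sum /closed_sum opprD addrACA subrr add0r.
suff -> : \sum_(m < M) (1 - V 0) * Vi 0 ^+ m.+1 * qpoch m =
          \sum_(m < M) X * v ^+ m.+1 * qpoch m by [].
by apply: eq_bigr => m _; rewrite /V /Vi !expr0 !mulr1 opprB addrC subrK.
Qed.

End FunctionalEquation.

(** * Specialization to posets counted by elements and minimal elements *)

Definition fps_zt : fps := fps_z * fps_t.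
Definition inv1zt : fps := fps_inv (1 - fps_zt).
Definition inv1t : fps := fps_inv (1 - fps_t).

Lemma inv1tK : (1 - fps_t) * inv1t = 1.
Proof. exact: fps_mulVf. Qed.

Lemma tdvd_zt : tdvd 1 fps_zt.
Proof. by apply: tdvdMl; apply: tdvd_t. Qed.

Lemma inv1ztK : (1 - fps_zt) * inv1zt = 1.
Proof. by apply: fps_mulVf; rewrite fpsDE fpsNE tdvd_zt. Qed.

Lemma term8E m : term8 m = fps_zt * inv1zt ^+ m.+1 * qpoch fps_t m.
Proof.
rewrite /term8 fps_prod_bigE fps_powE.
change (fps_zt * fps_inv ((1 - fps_zt) ^+ m.+1) *
  (\prod_(i <- iota 1 m) (1 - fps_pow (1 - fps_t) i)) =
  fps_zt * inv1zt ^+ m.+1 * qpoch fps_t m).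
congr (_ * _ * _); last by apply: eq_bigr => i _; rewrite fps_powE.
(* The inverse of the power and the power of the inverse are both inverses of [a], hence equal; [a]
   has constant term 1. *)
set a := (1 - fps_zt) ^+ m.+1.
have aV : a * fps_inv a = 1.
  apply: fps_mulVf.
  have : tdvd 1 (1 - a).
    rewrite /a; elim: m.+1 => [|i IHi]; first by rewrite expr0 subrr; apply: tdvd0.
    rewrite (_ : _ - _ = (1 - (1 - fps_zt) ^+ i) + (1 - fps_zt) ^+ i * fps_zt).
      by apply: tdvdD => //; apply: tdvdMl; apply: tdvd_zt.
    by rewrite exprS; ring.
  by move/(_ 0%N 0%N isT); rewrite fpsDE fpsNE => /eqP; rewrite subr_eq0 => /eqP<-.
have aW : a * inv1zt ^+ m.+1 = 1 by rewrite -exprMn inv1ztK expr1n.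
by rewrite -[LHS]mul1r -aW mulrAC aV mul1r.
Qed.

Lemma fps_tX a : fps_t ^+ a = coef2 'X^a.
Proof.
have -> : fps_t = coef2 'X.
  apply/funext => n; apply/funext => k; rewrite /coef2 /fps_t coefX.
  by case: n => [|[|n]]; rewrite /= ?coef0 // coef1; case: k.
elim: a => [|a IHa]; first by rewrite expr0 -[LHS]coef2_1 expr0.
by rewrite !exprS [in RHS]coef2M IHa.
Qed.

Lemma fps_zX b : fps_z ^+ b = coef2 ('X^b)%:P.
Proof.
have -> : fps_z = coef2 'X%:P.
  apply/funext => n; apply/funext => k; rewrite /coef2 /fps_z coefC.
  by case: n => [|n]; rewrite /= ?coef0 // coefX; case: (k == 1%N).
elim: b => [|b IHb]; first by rewrite expr0 -[LHS]coef2_1 expr0.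
by rewrite !exprS polyCM [in RHS]coef2M IHb.
Qed.

Lemma coef_monomial a b n k :
  (fps_t ^+ a * fps_z ^+ b) n k = ((n == a) && (k == b))%:R.
Proof.
rewrite fps_tX fps_zX.
change (fps_mul (coef2 'X^a) (coef2 ('X^b)%:P) n k = ((n == a) && (k == b))%:R).
rewrite -coef2M /coef2 coefMC coefXn.
by case: (n == a); rewrite ?mul1r ?mul0r ?coefXn ?coef0.
Qed.

Definition row_weight (u s : fps) (i : nat) : fps := if (i == 0)%N then u else s.

Lemma prod_row_weight m (N : 'I_m -> 'I_m -> nat) :
  \prod_(i < m) \prod_j row_weight fps_zt fps_t i ^+ N i j =
  fps_t ^+ (\sum_i \sum_j N i j) * fps_z ^+ (\sum_(i < m | i == 0 :> nat) \sum_j N i j).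
Proof.
rewrite !expr_sum [in X in _ * X]big_mkcond -big_split /=; apply: eq_bigr => i _.
rewrite -expr_sum /row_weight; case: ifP => _; last by rewrite mulr1.
by rewrite /fps_zt exprMn mulrC.
Qed.

(** Matrices are grouped by the positions of their nonzero entries; each such entry then ranges
    independently over the positive values up to [n]. *)
Lemma sum_by_support n m (w : nat -> fps) :
  \sum_(N : 'M['I_n.+1]_m | fishburn (map_mx (fun e : 'I_n.+1 => e != 0 :> nat) N))
     \prod_(i < m) \prod_j w i ^+ N i j =
  \sum_(S : 'M[bool]_m | fishburn S)
     \prod_(i < m) \prod_j (if S i j then \sum_(c < n.+1 | c != 0 :> nat) w i ^+ c else 1).
Proof.
rewrite (partition_big (map_mx (fun e : 'I_n.+1 => e != 0 :> nat)) (fun S => fishburn S)) //=.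
apply: eq_bigr => S fS; rewrite pair_big /=.
transitivity (\prod_(p : 'I_m * 'I_m)
   \sum_(c < n.+1 | (c != 0 :> nat) == S p.1 p.2) w p.1 ^+ c); last first.
  apply: eq_bigr => -[i j] _ /=; case: (S i j).
    by apply: eq_bigl => c; rewrite eqb_id.
  by rewrite (big_pred1 ord0) ?expr0 // => c; rewrite eqbF_neg negbK.
rewrite bigA_distr_big_dep /=.
rewrite (reindex (fun f : {ffun 'I_m * 'I_m -> 'I_n.+1} => \matrix_(i, j) f (i, j))) /=; last first.
  exists (fun N : 'M_m => [ffun p => N p.1 p.2]) => [f _|N _].
    by apply/ffunP => -[i j]; rewrite ffunE mxE.
  by apply/matrixP => i j; rewrite mxE ffunE.
apply: eq_big => [f|f _]; last first.
  by rewrite pair_big /=; apply: eq_bigr => -[i j] _; rewrite mxE.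
apply/andP/familyP => [[_ /eqP SE] [i j]|fam].
  by rewrite unfold_in -SE !mxE.
have SE : map_mx (fun e : 'I_n.+1 => e != 0 :> nat) (\matrix_(i, j) f (i, j)) = S.
  by apply/matrixP => i j; rewrite !mxE; have := fam (i, j); rewrite unfold_in => /eqP.
by rewrite SE fS.
Qed.

(** Entries are bounded by [n], so a positive entry contributes a truncated geometric series; the
    omitted tail is [w * T ^+ n.+1]. *)
Lemma tdvd_geometric n (T w : fps) : (1 - T) * w = 1 -> tdvd 1 T ->
  tdvd n.+1 (\sum_(c < n.+1 | c != 0 :> nat) T ^+ c - (w - 1)).
Proof.
move=> wK T1; have TX i : tdvd i (T ^+ i).
  by elim: i => [//|i IHi]; rewrite exprS; apply: (tdvdM T1).
have geo : \sum_(c < n.+1) T ^+ c = w - w * T ^+ n.+1.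
  have := subrX1 T n.+1; set G := \sum_(c < _) _ => e.
  transitivity (((1 - T) * w) * G); first by rewrite wK mul1r.
  transitivity (- w * ((T - 1) * G)); first by ring.
  by rewrite -e; ring.
have -> : \sum_(c < n.+1 | c != 0 :> nat) T ^+ c = \sum_(c < n.+1) T ^+ c - 1.
  by rewrite [in RHS](bigD1 ord0) //= expr0 [1 + _]addrC addrK.
rewrite geo (_ : _ - _ = - (w * T ^+ n.+1)); last by ring.
by apply: tdvdN; apply: tdvdMl; apply: TX.
Qed.

(** Replacing [u] by [u + s + u * s] multiplies [1 + u] by [1 + s = w], that is, raises [j] by
    one. *)
Lemma fishburn_gf_split_iter (v w : fps) m j :
  fishburn_gf m.+1 (v * w ^+ j - 1) (w - 1) = split_iter v w m j.
Proof.
elim: m j => [|m IHm] j; first by rewrite fishburn_gf1.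
rewrite fishburn_gfSS /= -!IHm; congr (_ * (fishburn_gf _ _ _ - _)).
by rewrite exprS; ring.
Qed.

Lemma p22_coef n k :
  (p22 n k)%:Z = (\sum_(m < n.+1) fishburn_gf m (inv1zt - 1) (inv1t - 1)) n k.
Proof.
rewrite p22_eq_card_fishburn -sum1_card fps_sumE.
rewrite (eq_bigl (fun c => true && fishburn_code k c)); last by move=> c; rewrite inE.
rewrite -(sig_big_dep (fun _ => true)
  (fun (m : 'I_n.+1) N => fishburn_code k (Tagged (fun m : 'I_n.+1 => 'M_m) N))
  (fun _ _ => 1%N)) /=.
rewrite -natz natr_sum; apply: eq_bigr => m _; rewrite natr_sum.
set wt := row_weight fps_zt fps_t.
(* [G] counts matrices with entries at most [n] exactly; allowing arbitrary entries changes it only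
   by multiples of [t ^ n.+1], invisible at [n]. *)
pose G : fps := \sum_(N : 'M['I_n.+1]_m | fishburn (map_mx (fun e : 'I_n.+1 => e != 0 :> nat) N))
     \prod_(i < m) \prod_j wt i ^+ N i j.
have GE : tdvd n.+1 (G - fishburn_gf m (inv1zt - 1) (inv1t - 1)).
  rewrite /G sum_by_support -sumrB; apply: tdvd_sum => S _.
  apply: tdvd_prodB => i _; apply: tdvd_prodB => j _.
  case: (S i j); last by rewrite subrr; apply: tdvd0.
  rewrite /wt /row_weight; case: ifP => _; apply: tdvd_geometric.
  - exact: inv1ztK.
  - exact: tdvd_zt.
  - exact: inv1tK.
  - exact: tdvd_t.
transitivity (G n k); last first.
  by have /eqP := GE n k (ltnSn n); rewrite fpsDE fpsNE subr_eq0 => /eqP.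
rewrite /G fps_sumE big_mkcond [RHS]big_mkcond; apply: eq_bigr => N _.
rewrite /fishburn_code /=; set N' := \matrix_(i, j) _.
have -> : map_mx (fun e => e != 0)%N N' = map_mx (fun e : 'I_n.+1 => e != 0 :> nat) N.
  by apply/matrixP => i j; rewrite !mxE.
have N'E (P : pred 'I_m) : (\sum_(i | P i) \sum_j N' i j = \sum_(i | P i) \sum_j N i j)%N.
  by apply: eq_bigr => i _; apply: eq_bigr => j _; rewrite mxE.
rewrite !N'E; case: (fishburn _) => //=.
have -> : \prod_(i < m) \prod_j wt i ^+ N i j = _ := prod_row_weight (fun i j => N i j).
by rewrite coef_monomial [n == _]eq_sym [k == _]eq_sym; case: ifP.
Qed.

(* The infinite sum over m >= 0 is the formal (coefficientwise eventually
   stable) limit of the partial sums 1 + sum_{m < M} term8 m. *)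
Theorem theorem8 :
  forall n k : nat, exists N : nat, forall M : nat, (N <= M)%N ->
    fps_add fps_one (fps_sum (iota 0 M) term8) n k = (p22 n k)%:Z.
Proof.
(* Closed and combinatorial sums of [M] terms differ by a multiple of [t ^ M], so [M > n]
   suffices. *)
move=> n k; exists n.+1 => M ltnM; rewrite p22_coef fps_sum_bigE.
change ((1 + \sum_(m <- iota 0 M) term8 m) n k =
  (\sum_(m < n.+1) fishburn_gf m (inv1zt - 1) (inv1t - 1)) n k).
rewrite big_ord_recl fishburn_gf0 !fpsDE; congr (_ + _).
under eq_bigr do rewrite term8E; rewrite -[M in iota 0 M]subn0 big_mkord.
have /(_ n k ltnM)/eqP := split_iter_sum inv1ztK inv1tK tdvd_zt tdvd_t (M := M).
rewrite fpsDE fpsNE subr_eq0 => /eqP<-.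
(* The terms of index at least [n] are divisible by [t ^ n.+1] and drop out of this coefficient. *)
rewrite -(subnKC (ltnW ltnM)) big_split_ord /= fpsDE.
rewrite [X in _ + X](_ : _ = 0) ?addr0.
  congr (_ n k); apply: eq_bigr => m _.
  by rewrite -fishburn_gf_split_iter expr0 mulr1.
rewrite fps_sumE; apply: big1 => m _.
by apply: (tdvd_split_iter inv1ztK inv1tK tdvd_zt tdvd_t); rewrite ltnS leq_addr.
Qed.
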